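(* Let $q$ be a prime power and let $n>1$ and $m$ be positive integers. Let $b\in\mathbb{F}_{q^n}$ with $b^{q^{n-1}+q^{n-2}+\cdots+q^2+q+1}=1$, and let $$A(x)=x^{q^{n-1}}+\sum_{j=0}^{n-2} b^{1+\sum_{i=1}^{j}q^{n-i}}\,x^{q^{n-j-2}}$$ (that is, $A(x)=x^{q^{n-1}}+bx^{q^{n-2}}+b^{1+q^{n-1}}x^{q^{n-3}}+\cdots+b^{1+\sum_{i=1}^{n-2}q^{n-i}}x$). Let $L(x)=\sum_{i=0}^{n-1}a_ix^{q^i}$ with $a_i\in\mathbb{F}_{q^n}$ be a linearized polynomial over $\mathbb{F}_{q^n}$ that is not a permutation polynomial over $\mathbb{F}_{q^n}$, and let $D$ be its associated Dickson matrix. Let $(\alpha_1,\alpha_2,\dots,\alpha_n)$ be a non-zero solution (over $\mathbb{F}_{q^n}$) of the system of linear equations $D^{T}x=O$. Then the polynomial $$f(x)=A(x)^m+L(x)$$ is a permutation polynomial over $\mathbb{F}_{q^n}$ if and only if all of the following hold: $\gcd(m,q-1)=1$; $\operatorname{rank}(D)=n-1$; $$\alpha_1+\alpha_2b^{qm}+\alpha_3b^{q^2m+qm}+\cdots+\alpha_nb^{m\sum_{i=1}^{n-1}q^i}\neq 0;$$ and the determinant of the $n\times n$ matrix $$B=\begin{pmatrix} b^{1+\sum_{i=1}^{n-2}q^{n-i}} & a_0 & a_{n-1}^q & a_{n-2}^{q^2} & \cdots & a_2^{q^{n-2}}\\ b^{1+\sum_{i=1}^{n-3}q^{n-i}} &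 a_1 & a_0^q & a_{n-1}^{q^2} & \cdots & a_3^{q^{n-2}}\\ \vdots & \vdots & \vdots & \vdots & & \vdots\\ b & a_{n-2} & a_{n-3}^q & a_{n-4}^{q^2} & \cdots & a_0^{q^{n-2}}\\ 1 & a_{n-1} & a_{n-2}^q & a_{n-3}^{q^2} & \cdots & a_1^{q^{n-2}} \end{pmatrix}$$ is non-zero.
   Context: A polynomial over $\mathbb{F}_{q^n}$ is a permutation polynomial over $\mathbb{F}_{q^n}$ if its evaluation map $\mathbb{F}_{q^n}\to\mathbb{F}_{q^n}$ is bijective. The Dickson matrix associated to $L(x)=\sum_{i=0}^{n-1}a_ix^{q^i}$ is the $n\times n$ matrix over $\mathbb{F}_{q^n}$ $$D=\begin{pmatrix} a_0&a_1&\cdots&a_{n-1}\\ a_{n-1}^{q}&a_0^{q}&\cdots&a_{n-2}^{q}\\ \vdots&\vdots&&\vdots\\ a_1^{q^{n-1}}&a_2^{q^{n-1}}&\cdots&a_0^{q^{n-1}}\end{pmatrix},$$ i.e. with rows and columns indexed by $0,\dots,n-1$, the $(i,j)$ entry is $a_{(j-i)\bmod n}^{q^i}$. $D^T$ is its transpose and $O$ the zero vector. The first column of $B$ lists the coefficients in $A(x)$ of $x,x^q,\dots,x^{q^{n-1}}$ from top to bottom, and the last $n-1$ columns of $B$ are the transposes of the first $n-1$ rows of $D$, in order. Empty sums in exponents are $0$. *)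

(* Defs.v *)
From mathcomp Require Import all_boot all_order all_algebra.
From mathcomp Require Import zify.
Set Implicit Arguments.
Unset Strict Implicit.
Unset Printing Implicit Defensive.
Import GRing.Theory.
Local Open Scope ring_scope.

Definition is_prime_power (q : nat) : Prop :=
  exists p k : nat, [/\ prime p, (0 < k)%N & q = (p ^ k)%N].

Definition permutation_polynomial (F : finFieldType) (f : {poly F}) : Prop :=
  bijective (fun x : F => f.[x]).

Lemma ord_pos (n : nat) (i : 'I_n) : (0 < n)%N.
Proof. exact: leq_ltn_trans (leq0n i) (ltn_ord i). Qed.

(* (j - i) mod n; the summand n keeps the truncated subtraction exact. *)
Definition ord_subm (n : nat) (j i : 'I_n) : 'I_n :=
  Ordinal (ltn_pmod (j + n - i) (ord_pos i)).

Definition linearized_poly (F : finFieldType) (q n : nat) (a : 'I_n -> F) :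
    {poly F} :=
  \sum_(i < n) a i *: 'X^(q ^ i).

Definition Dickson_mx (F : finFieldType) (q n : nat) (a : 'I_n -> F) :
    'M[F]_n :=
  \matrix_(i < n, j < n) a (ord_subm j i) ^+ (q ^ i).

Definition A_poly (F : finFieldType) (q n : nat) (b : F) : {poly F} :=
  'X^(q ^ n.-1) +
  \sum_(j < n.-1)
     b ^+ (1 + \sum_(1 <= i < j.+1) q ^ (n - i)) *: 'X^(q ^ (n - j - 2)).

(* For j > 0, [ord_pred j] is j - 1 (no wrap-around), so column j of B is the
   transpose of row j - 1 of the Dickson matrix; the last row is not used. *)
Definition B_mx (F : finFieldType) (q n : nat) (b : F) (a : 'I_n -> F) :
    'M[F]_n :=
  \matrix_(i < n, j < n)
    if j == 0 :> nat then (A_poly q n b)`_(q ^ i)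
    else Dickson_mx q a (ord_pred j) i.

(* The entries of the first column of B, written out as powers of b. *)
Lemma coef_A_poly (F : finFieldType) (q n : nat) (b : F) (i : 'I_n) :
    (1 < q)%N ->
  (A_poly q n b)`_(q ^ i) =
    if i == n.-1 :> nat then 1
    else b ^+ (1 + \sum_(1 <= k < n - 1 - i) q ^ (n - k)).
Proof.
move=> q1; have hi := ltn_ord i.
rewrite coefD coefXn coef_sum eqn_exp2l //.
have cE (c : F) k : (c *: 'X^(q ^ k))`_(q ^ i) = c * (i == k :> nat)%:R.
  by rewrite coefZ coefXn eqn_exp2l.
rewrite (eq_bigr _ (fun j _ => cE _ _)).
have [Ei|Ni] := eqVneq (i : nat) n.-1.
  rewrite big1 ?addr0 // => j _; have hj := ltn_ord j.
  by rewrite (_ : (_ == _) = false) ?mulr0 //; lia.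
have hk : (n - 2 - i < n.-1)%N by lia.
rewrite (bigD1 (Ordinal hk)) //= [X in _ + (_ + X)]big1 => [|j Nj]; last first.
  have hj := ltn_ord j; have Nj' : (j != n - 2 - i :> nat)%N by [].
  by rewrite (_ : (_ == _) = false) ?mulr0 //; lia.
have -> : (i == n - (n - 2 - i) - 2 :> nat)%N by lia.
rewrite mulr1 addr0 add0r (_ : (n - 2 - i).+1 = (n - 1 - i)%N) //; lia.
Qed.

(* Main.v *)
Require Import Defs.
From mathcomp Require Import all_boot all_order all_algebra.
From mathcomp Require Import all_fingroup all_solvable finfield zify.

Set Implicit Arguments.
Unset Strict Implicit.
Unset Printing Implicit Defensive.
Import GRing.Theory.
Local Open Scope ring_scope.

(** The norm condition on [b] gives [A(x)^q = b^q A(x)] ([A_poly_frobenius]).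
    So the values of [A] lie on the line [z^q = b^q z], which has dimension at
    most one over the field with [q] elements, and the values of [A^m] lie on
    the line [z^q = b^(qm) z]. On the second line every linearized polynomial
    acts as a scalar ([horner_linearized_eigen]). Apply this to the polynomial
    [alphaP] whose coefficients are the [alpha_i]: the equation
    [D^T alpha = 0] means that [alphaP] vanishes on the image of [L]
    ([horner_Dickson_ker]), and therefore
    [alphaP (A(x)^m + L(x)) = S A(x)^m], where [S] is the sum in the third
    condition.

    The determinant of [B] detects the common zeros of [A] and [L]: since [L]
    has a non-zero root, the determinant is non-zero if and only if 0 is the
    only common zero ([det_B_ker], [ker_det_B]). A non-zero determinant also
    forces the rank of [D] to be [n - 1] ([rank_Dickson]).

    Suppose that the four conditions hold and that [x], [y] have the same image.
    Applying [alphaP] and cancelling [S] gives [A(x)^m = A(y)^m], hence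
    [L(x) = L(y)]. The two values of [A] are on one line, so when they are
    non-zero their ratio [u] satisfies [u^m = u^(q-1) = 1], and [u = 1] by
    coprimality. So [x - y] is a common zero of [A] and [L], and [x = y].

    Conversely, let the polynomial permute the field. It sends every common zero
    of [A] and [L] to 0, so 0 is the only one and [B] is invertible. If [S] were
    zero, [alphaP] would vanish on the whole field, although its degree is less
    than the cardinality of the field. If some prime divided both [m] and
    [q - 1], there would be [u != 1] with [u^m = u^(q-1) = 1], and for a
    non-zero root [x0] of [L] the points [x0] and [u x0] would have the same
    image, since [A] and [L] commute with multiplication by [u]. *)

(** * Preliminaries *)

(** Each fibre of an additive map is contained in a translate of its kernel. *)
Lemma card_leq_kernel_image (V W : finZmodType) (f : V -> W) :
    {morph f : x y / x - y} ->
  (#|V| <= #|[set x | f x == 0%R]| * #|[set f x | x : V]|)%N.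
Proof.
move=> fB; rewrite -cardsT -sum1_card mulnC -sum_nat_const.
rewrite (partition_big f (mem [set f x | x : V])) => [|x _]; last exact: imset_f.
apply: leq_sum => _ /imsetP[x0 _ ->].
rewrite sum1_card -(card_imset _ (addIr (- x0))).
apply: subset_leq_card; apply/subsetP => _ /imsetP[x /andP[_ /eqP fx] ->].
by rewrite inE fB fx subrr.
Qed.

Lemma ord_submE n (j i : 'I_n) :
  ord_subm j i = (if (i <= j)%N then j - i else j + n - i)%N :> nat.
Proof.
have [hi hj] := (ltn_ord i, ltn_ord j).
rewrite /=; case: leqP => ij; last by rewrite modn_small //; lia.
by rewrite -addnBAC // modnDr modn_small //; lia.
Qed.

(** The exponent of [b] in the coefficient of [x^(q^(n+1-j))] in the polynomial
    [A] of an extension of degree [n.+2]: with this numbering, the leading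
    coefficient 1 is the case [j = 0] of a uniform formula. *)
Definition A_exp (q n j : nat) : nat :=
  if j is j'.+1 then 1 + \sum_(1 <= i < j'.+1) q ^ (n.+2 - i) else 0.

(** The next two lemmas are the arithmetic behind [A(x)^q = b^q A(x)]: raising
    to the power [q] shifts each coefficient of [A] to the next one, up to the
    factor [b^q], and the norm exponent appears where the shift wraps around. *)
Lemma A_exp_norm q n : (q + A_exp q n n.+1)%N = (\sum_(0 <= i < n.+2) q ^ i)%N.
Proof.
rewrite big_nat_recl // [in RHS]big_nat_recl // addnCA; congr (_ + (_ + _))%N.
by rewrite big_add1 big_nat_rev; apply: eq_big_nat => i hi; congr expn; lia.
Qed.

(** The condition [d ^+ (q ^ n.+2) = d] is what closes the recursion: the term
    [q ^ (n.+2 - 1)] of the exponent on the left becomes [q ^ n.+2], whose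
    contribution to the power of [d] is [d] itself. *)
Lemma A_exp_step (R : nzRingType) (q n j : nat) (d : R) :
    d ^+ (q ^ n.+2) = d -> (j <= n)%N ->
  d ^+ (A_exp q n j.+1 * q) = d ^+ (q + A_exp q n j).
Proof.
move=> dE; case: j => [|j] jn.
  by rewrite /A_exp big_geq // addn0 mul1n addn0.
rewrite /A_exp big_nat_recl // mulnDl mul1n mulnDl -expnSr subn1 /= big_distrl.
rewrite !exprD dE expr1; congr (_ * (_ * _ ^+ _)).
by apply: eq_big_nat => i hi; rewrite /= -expnSr; congr expn; lia.
Qed.

(** * Evaluation of linearized polynomials *)

Section Linearized.

Variables (F : finFieldType) (q : nat).
Hypothesis q_pchar : [pchar F].-nat q.

Lemma frobeniusD i (x y : F) : (x + y) ^+ (q ^ i) = x ^+ (q ^ i) + y ^+ (q ^ i).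
Proof. by rewrite exprDn_pchar // pnatX q_pchar. Qed.

Lemma frobenius_sum i (I : finType) (E : I -> F) :
  (\sum_j E j) ^+ (q ^ i) = \sum_j E j ^+ (q ^ i).
Proof.
apply: (big_morph (fun x : F => x ^+ (q ^ i)) (frobeniusD i)).
by rewrite expr0n expn_eq0; case: q q_pchar.
Qed.

Lemma horner_linearized n (c : 'I_n -> F) x :
  (linearized_poly q c).[x] = \sum_(i < n) c i * x ^+ (q ^ i).
Proof.
by rewrite horner_sum; apply: eq_bigr => i _; rewrite hornerZ hornerXn.
Qed.

Lemma horner_linearizedB n (c : 'I_n -> F) :
  {morph (fun x => (linearized_poly q c).[x]) : x y / x - y}.
Proof.
move=> x y; apply/eqP; rewrite eq_sym subr_eq !horner_linearized -big_split /=.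
apply/eqP/eq_bigr => i _.
by rewrite -mulrDr -frobeniusD subrK.
Qed.

Lemma horner_linearized0 n (c : 'I_n -> F) : (linearized_poly q c).[0] = 0.
Proof. by have /= := horner_linearizedB c 0 0; rewrite !subrr. Qed.

(** Iterating Frobenius on an element of the line [z^q = d^q z] multiplies it
    by successive conjugates of [d]. *)
Lemma frobenius_iter (d z : F) i : z ^+ q = d ^+ q * z ->
  z ^+ (q ^ i) = d ^+ (\sum_(1 <= k < i.+1) q ^ k) * z.
Proof.
move=> zE; elim: i => [|i IH]; first by rewrite big_geq // expr0 mul1r.
rewrite expnSr exprM IH exprMn zE mulrA -exprM -exprD; congr (_ ^+ _ * _).
rewrite [RHS]big_nat_recl // expn1 addnC; congr addn.
by rewrite big_distrl; apply: eq_bigr => k _; rewrite /= -expnSr.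
Qed.

(** Every linearized polynomial acts on the line [z^q = d^q z] as a scalar. For
    [d = b^m], and the coefficients [alpha], this scalar is the sum in the third
    condition of the theorem. *)
Lemma horner_linearized_eigen n (c : 'I_n -> F) (d z : F) :
    z ^+ q = d ^+ q * z ->
  (linearized_poly q c).[z]
    = z * \sum_(i < n) c i * d ^+ (\sum_(1 <= k < i.+1) q ^ k).
Proof.
move=> zE; rewrite horner_linearized mulr_sumr; apply: eq_bigr => i _.
by rewrite (frobenius_iter _ zE) mulrA mulrC.
Qed.

Lemma horner_linearizedM n (c : 'I_n -> F) (u x : F) :
  u ^+ q = u -> (linearized_poly q c).[u * x] = u * (linearized_poly q c).[x].
Proof.
move=> uE; rewrite !horner_linearized mulr_sumr; apply: eq_bigr => i _.
by rewrite exprMn mulrCA (frobenius_iter (d := 1)) ?expr1n ?mul1r // expr1n mul1r.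
Qed.

Hypothesis q_gt1 : (1 < q)%N.

Lemma coef_linearized n (c : 'I_n -> F) (i : 'I_n) :
  (linearized_poly q c)`_(q ^ i) = c i.
Proof.
rewrite coef_sum (bigD1 i) //= coefZ coefXn eqxx mulr1 big1 ?addr0 // => j ji.
rewrite coefZ coefXn eqn_exp2l // (inj_eq (@ord_inj _)) eq_sym (negbTE ji).
by rewrite mulr0.
Qed.

(** A linearized polynomial with [n.+1] coefficients has degree at most
    [q ^ n], so it has too few roots unless it is zero. *)
Lemma linearized_roots_eq0 n (c : 'I_n.+1 -> F) (R : {set F}) :
    (forall x, x \in R -> (linearized_poly q c).[x] = 0) -> (q ^ n < #|R|)%N ->
  forall i, c i = 0.
Proof.
move=> R0 ltR i; rewrite -(coef_linearized c); set p := linearized_poly q c.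
have [->|p_neq0] := eqVneq p 0; first by rewrite coef0.
have lt_size: (#|R| < size p)%N.
  rewrite cardE; apply: max_poly_roots (enum_uniq R) => //.
  by apply/allP => x; rewrite mem_enum => /R0/eqP.
have: (size p <= (q ^ n).+1)%N.
  apply/(leq_trans (size_sum _ _ _))/bigmax_leqP => j _.
  rewrite (leq_trans (size_scale_leq _ _)) // size_polyXn ltnS leq_exp2l //.
  by rewrite -ltnS.
by move/(leq_trans lt_size); rewrite ltnS leqNgt ltR.
Qed.

(** The solutions are the roots of the linearized polynomial 'X^q - d 'X. *)
Lemma card_frobenius_eigen (d : F) :
  (#|[set z : F | (z ^+ q)%R == (d * z)%R]| <= q)%N.
Proof.
rewrite leqNgt; apply/negP => ltq.
pose c (i : 'I_2) : F := if i == 0 :> nat then - d else 1.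
suff /(_ ord_max)/eqP : forall i, c i = 0 by rewrite oner_eq0.
apply: (linearized_roots_eq0 (R := [set z : F | z ^+ q == d * z])) => // z.
rewrite inE => /eqP zE; rewrite horner_linearized !big_ord_recl big_ord0 /c /=.
by rewrite zE addr0 mul1r mulNr addNr.
Qed.

(** * Dickson matrices *)

Section Extension.

Variable n : nat.
Hypothesis cardF : #|F| = (q ^ n)%N.

(** The rows of the Dickson matrix are the coefficients of the conjugates
    [L^(q^i)], reduced modulo [x^(q^n) = x]. *)
Lemma horner_linearized_frobenius (a : 'I_n -> F) (i : 'I_n) x :
  (linearized_poly q a).[x] ^+ (q ^ i)
    = \sum_j Dickson_mx q a i j * x ^+ (q ^ j).
Proof.
have ord_subm_inj : injective (@ord_subm n ^~ i).
  move=> j k /(congr1 (@nat_of_ord n)); rewrite !ord_submE => E; apply: ord_inj.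
  have [[hi hj] hk] := (ltn_ord i, ltn_ord j, ltn_ord k).
  by move: E; case: (leqP i j) => ?; case: (leqP i k) => ?; lia.
rewrite horner_linearized frobenius_sum (reindex_inj ord_subm_inj).
apply: eq_bigr => j _; rewrite exprMn -exprM -expnD mxE ord_submE; congr (_ * _).
case: leqP => [ij|ji]; first by rewrite subnK.
rewrite subnK; last by have := ltn_ord i; lia.
by rewrite addnC expnD exprM -cardF expf_card.
Qed.

(** A solution of the transposed Dickson system is a linear relation between
    the conjugates [L^(q^i)], that is, a linearized polynomial vanishing on the
    image of [L]. *)
Lemma horner_Dickson_ker (a : 'I_n -> F) (alpha : 'cV[F]_n) x :
    (Dickson_mx q a)^T *m alpha = 0 ->
  (linearized_poly q (alpha ^~ 0)).[(linearized_poly q a).[x]] = 0.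
Proof.
move=> /colP sol; rewrite horner_linearized.
under eq_bigr => i _ do rewrite horner_linearized_frobenius mulr_sumr.
rewrite exchange_big big1 // => j _.
have := sol j; rewrite !mxE => /(congr1 ( *%R^~ (x ^+ (q ^ j)))).
rewrite mul0r mulr_suml => E; rewrite -[RHS]E; apply: eq_bigr => i _.
by rewrite !mxE mulrA [alpha _ _ * _]mulrC.
Qed.

End Extension.

(** * The polynomial A and the matrix B *)

Section AMap.

Variables (n : nat) (b : F).
Hypothesis cardF : #|F| = (q ^ n.+2)%N.
Hypothesis b_norm : b ^+ (\sum_(0 <= i < n.+2) q ^ i) = 1.

Lemma A_poly_sum :
  A_poly q n.+2 b = \sum_(j < n.+2) b ^+ A_exp q n j *: 'X^(q ^ (n.+1 - j)).
Proof.
rewrite big_ord_recl scale1r; congr (_ + _); apply: eq_bigr => j _.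
by rewrite -subnDA addn2.
Qed.

(** The coefficients are left in the form in which they enter the first column
    of [B_mx]. *)
Lemma A_poly_linearized :
  A_poly q n.+2 b
    = linearized_poly q (fun i : 'I_n.+2 => (A_poly q n.+2 b)`_(q ^ i)).
Proof.
have E : A_poly q n.+2 b
    = linearized_poly q (fun i : 'I_n.+2 => b ^+ A_exp q n (n.+1 - i)).
  rewrite A_poly_sum (reindex_inj rev_ord_inj); apply: eq_bigr => i _ /=.
  by rewrite subSS subKn // -ltnS.
by rewrite {1}E; apply: eq_bigr => i _; rewrite E coef_linearized.
Qed.

(** The image of [A] lies in the line [z^q = b^q z], of dimension at most one
    over the field with [q] elements. The norm condition on [b] is what makes
    the two sides agree on the coefficient of [x]. *)
Lemma A_poly_frobenius x :
  (A_poly q n.+2 b).[x] ^+ q = b ^+ q * (A_poly q n.+2 b).[x].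
Proof.
have -> : (A_poly q n.+2 b).[x]
    = \sum_(j < n.+2) b ^+ A_exp q n j * x ^+ (q ^ (n.+1 - j)).
  by rewrite A_poly_sum horner_sum; apply: eq_bigr => j _; rewrite !hornerE.
rewrite -[X in _ ^+ X = _]expn1 frobenius_sum mulr_sumr.
rewrite big_ord_recl [in RHS]big_ord_recr addrC expn1; congr (_ + _).
  apply: eq_bigr => i _; rewrite lift0 exprMn -!exprM A_exp_step; last first.
  - by rewrite -ltnS.
  - by rewrite -cardF expf_card.
  rewrite mulrA -exprD -expnSr; congr (_ * _ ^+ (_ ^ _)).
  by have /= := ltn_ord i; lia.
rewrite mulrA -exprD A_exp_norm b_norm expr0 !mul1r subn0 subnn expr1.
by rewrite -exprM -expnSr -cardF expf_card.
Qed.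

Variable a : 'I_n.+2 -> F.

(** The columns of [B_mx] are the coefficients of [A] and of the first
    conjugates of [L], so pairing them with the powers [x^(q^i)] evaluates these
    polynomials at [x]. *)
Lemma moore_row_B x (j : 'I_n.+2) :
  ((\row_i x ^+ (q ^ i)) *m B_mx q b a) 0 j
    = if j == 0 :> nat then (A_poly q n.+2 b).[x]
      else (linearized_poly q a).[x] ^+ (q ^ j.-1).
Proof.
rewrite mxE; case: ifP => j0.
  rewrite A_poly_linearized horner_linearized; apply: eq_bigr => i _.
  by rewrite !mxE j0 mulrC.
have -> : j.-1 = ord_pred j.
  rewrite /=; have := ltn_ord j; case: (nat_of_ord j) j0 => // k _ hk.
  by rewrite addSn /= modnDr modn_small // ltnW.
rewrite horner_linearized_frobenius //; apply: eq_bigr => i _.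
by rewrite [B_mx q b a i j]mxE j0 mxE mulrC.
Qed.

(** A common zero [x] of [A] and [L] puts the row of the powers [x^(q^i)] in
    the left kernel of [B_mx]. *)
Lemma det_B_ker x :
    \det (B_mx q b a) != 0 -> (A_poly q n.+2 b).[x] = 0 ->
  (linearized_poly q a).[x] = 0 -> x = 0.
Proof.
move=> detB Ax Lx; apply/eqP; apply: contraNT detB => x_neq0.
apply/det0P; exists (\row_i x ^+ (q ^ i)).
  apply/eqP => /rowP/(_ 0); rewrite !mxE expn0 expr1.
  by apply/eqP.
apply/rowP => j; rewrite moore_row_B Ax Lx mxE expr0n expn_eq0.
by rewrite eqn0Ngt (ltnW q_gt1) /= if_same.
Qed.

(** [A] embeds the kernel of [L] into the line [z^q = b^q z]. *)
Lemma card_ker_linearized :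
    (forall x, (A_poly q n.+2 b).[x] = 0 -> (linearized_poly q a).[x] = 0 ->
      x = 0) ->
  (#|[set x | (linearized_poly q a).[x] == 0%R]| <= q)%N.
Proof.
move=> kerAL; apply: leq_trans (card_frobenius_eigen (b ^+ q)).
rewrite -(card_in_imset (f := fun x => (A_poly q n.+2 b).[x])) => [|x y].
  apply/subset_leq_card/subsetP => _ /imsetP[x _ ->].
  by rewrite inE A_poly_frobenius.
rewrite !inE => /eqP Lx /eqP Ly Axy.
apply/eqP; rewrite -subr_eq0; apply/eqP/kerAL.
  by rewrite A_poly_linearized horner_linearizedB -!A_poly_linearized Axy subrr.
by rewrite horner_linearizedB Lx Ly subrr.
Qed.

(** A linear relation between the columns of [B_mx] gives
    [v_0 A(x) + sum_i v_(i+1) L(x)^(q^i) = 0] for all [x], the sum running over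
    [i <= n]. Evaluating it at a non-zero element of the kernel of [L] gives
    [v_0 = 0]. What remains is a linearized polynomial of degree at most [q ^ n]
    vanishing on the image of [L]; this image has at least [q ^ n.+1] elements
    because the kernel of [L] has at most [q], so all the [v_i] are zero. *)
Lemma ker_det_B x0 :
    x0 != 0 -> (linearized_poly q a).[x0] = 0 ->
    (forall x, (A_poly q n.+2 b).[x] = 0 -> (linearized_poly q a).[x] = 0 ->
      x = 0) ->
  \det (B_mx q b a) != 0.
Proof.
move=> x0_neq0 Lx0 kerAL; rewrite -det_tr; apply/det0P => -[v v_neq0 vB].
have rel x : (A_poly q n.+2 b).[x] * v 0 0
    + (linearized_poly q (fun i => v 0 (lift ord0 i))).[(linearized_poly q a).[x]]
    = 0.
  have /matrixP/(_ 0 0) : (\row_i x ^+ (q ^ i)) *m B_mx q b a *m v^T = 0.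
    by rewrite -mulmxA -[B_mx q b a]trmxK -trmx_mul vB trmx0 mulmx0.
  rewrite [RHS]mxE => <-; rewrite mxE big_ord_recl moore_row_B mxE; congr (_ + _).
  rewrite horner_linearized; apply: eq_bigr => i _.
  by rewrite moore_row_B mxE mulrC.
have v0 : v 0 0 = 0.
  move/eqP: (rel x0); rewrite Lx0 horner_linearized0 addr0 mulf_eq0.
  case/orP => /eqP // Ax0; case/eqP: x0_neq0; exact: kerAL.
case/eqP: v_neq0; apply/rowP => i; rewrite mxE.
have [j ->|->] := unliftP ord0 i; last exact: v0.
move: j; apply: (linearized_roots_eq0 (R := [set (linearized_poly q a).[x] | x : F])).
  by move=> _ /imsetP[x _ ->]; have := rel x; rewrite v0 mulr0 add0r.
have := card_leq_kernel_image (horner_linearizedB a).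
rewrite cardF => /leq_trans/(_ (leq_mul (card_ker_linearized kerAL) (leqnn _))).
rewrite expnS leq_pmul2l ?(ltnW q_gt1) // => /(leq_trans _); apply.
by rewrite ltn_exp2l.
Qed.

(** All the rows of the transpose of [B_mx] but one are rows of the Dickson
    matrix, which therefore has corank at most one when [B_mx] is invertible;
    the non-zero solution [alpha] makes the corank positive. *)
Lemma rank_Dickson (alpha : 'cV[F]_n.+2) :
    alpha != 0 -> (Dickson_mx q a)^T *m alpha = 0 -> \det (B_mx q b a) != 0 ->
  \rank (Dickson_mx q a) = n.+1.
Proof.
move=> alpha_neq0 sol detB; apply/eqP; rewrite eqn_leq; apply/andP; split.
  have := mulmx0_rank_max sol; rewrite mxrank_tr -[\rank alpha]mxrank_tr rank_rV.
  by rewrite trmx_eq0 alpha_neq0 addn1 ltnS.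
have /mxrank_unit rkB : (B_mx q b a)^T \in unitmx.
  by rewrite unitmxE det_tr unitfE.
have : ((B_mx q b a)^T <= row 0 (B_mx q b a)^T + Dickson_mx q a)%MS.
  apply/row_subP => i; have [j ->|->] := unliftP ord0 i; last exact: addsmxSl.
  apply: submx_trans (addsmxSr _ _).
  apply: (@eq_row_sub _ _ _ _ _ (ord_pred (lift ord0 j))).
  by apply/rowP => k; rewrite !mxE.
move/mxrankS/leq_trans/(_ (mxrank_adds_leqif _ _)).
by rewrite rkB rank_rV; case: (_ != 0) => // /ltnW.
Qed.

End AMap.

End Linearized.

(** * Powers in the field with q elements *)

(** By Cauchy's theorem the group of units has an element of order any prime
    divisor of the gcd; this order divides both [m] and [q - 1]. *)
Lemma exists_nontrivial_root (F : finFieldType) (q n m : nat) :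
    #|F| = (q ^ n)%N -> (1 < q)%N -> gcdn m (q - 1) != 1%N ->
  exists u : F, [/\ u != 1, u ^+ m = 1 & u ^+ q = u].
Proof.
move=> cardF q_gt1 g_neq1; set g := gcdn m (q - 1) in g_neq1.
have p_pr : prime (pdiv g).
  apply: pdiv_prime; rewrite ltn_neqAle eq_sym g_neq1 gcdn_gt0.
  by rewrite subn_gt0 q_gt1 orbT.
have [pm pq] : (pdiv g %| m)%N /\ (pdiv g %| q.-1)%N.
  by rewrite -subn1 !(dvdn_trans (pdiv_dvd _)) ?dvdn_gcdl ?dvdn_gcdr.
have [|u _ ou] := @Cauchy {unit F} (pdiv g) [set: {unit F}] p_pr.
  rewrite card_finField_unit cardF (dvdn_trans pq) //; exact: dvdn_pred_predX.
have uX k : (pdiv g %| k)%N -> val u ^+ k = 1.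
  by rewrite -ou order_dvdn -FinRing.val_unitX => /eqP->.
exists (val u); split.
- apply: contraTneq p_pr => u1; rewrite -ou (_ : u = 1%g) ?order1 //.
  exact: val_inj.
- exact: uX.
- by rewrite -(prednK (ltnW q_gt1)) exprS uX ?mulr1.
Qed.

Lemma coprime_expr_eq1 (F : fieldType) (q m : nat) (u : F) :
    (1 < q)%N -> (0 < m)%N -> gcdn m (q - 1) = 1%N ->
  u ^+ m = 1 -> u ^+ q = u -> u = 1.
Proof.
move=> q_gt1 m_gt0 g1 um uq.
have u1 : u ^+ (q - 1) = 1.
  have u_neq0 : u != 0.
    apply: contra_eq_neq um => ->.
    by rewrite expr0n eqn0Ngt m_gt0 eq_sym oner_eq0.
  by apply: (mulfI u_neq0); rewrite -exprS mulr1 subn1 prednK // ltnW.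
have [k l kl _] := egcdnP (q - 1) m_gt0.
have : u ^+ (k * m) = 1 by rewrite mulnC exprM um expr1n.
by rewrite kl g1 exprD expr1 mulnC exprM u1 expr1n mul1r.
Qed.

(** * The permutation criterion *)

Theorem theorem5 (F : finFieldType) (q n m : nat) (b : F) (a : 'I_n -> F)
    (alpha : 'cV[F]_n)
    (q_pp : is_prime_power q) (n_gt1 : (1 < n)%N) (m_gt0 : (0 < m)%N)
    (cardF : #|F| = (q ^ n)%N)
    (b_norm : b ^+ (\sum_(0 <= i < n) q ^ i) = 1)
    (L_not_perm : ~ permutation_polynomial (linearized_poly q a))
    (alpha_neq0 : alpha != 0)
    (alpha_sol : (Dickson_mx q a)^T *m alpha = 0) :
  permutation_polynomial (A_poly q n b ^+ m + linearized_poly q a) <->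
  [/\ gcdn m (q - 1) = 1%N,
      \rank (Dickson_mx q a) = (n - 1)%N,
      \sum_(i < n) alpha i 0 * b ^+ (m * \sum_(1 <= k < i.+1) q ^ k) != 0 &
      \det (B_mx q b a) != 0].
Proof.
have [q_gt1 q_pchar] : (1 < q)%N /\ [pchar F].-nat q.
  case: q_pp cardF => p [k [p_pr k_gt0 ->]].
  rewrite -expnM => /card_finPcharP/(_ p_pr) pF; split.
    by rewrite -(exp1n k) ltn_exp2r ?prime_gt1.
  by rewrite pnatX pnatE // pF.
case: n n_gt1 a alpha cardF b_norm L_not_perm alpha_neq0 alpha_sol => [|[|n]] // _.
move=> a alpha cardF b_norm L_not_perm alpha_neq0 alpha_sol.
set L := linearized_poly q a; set A := A_poly q n.+2 b.
set alphaP := linearized_poly q (alpha ^~ 0).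
have AB x y : A.[x - y] = A.[x] - A.[y].
  by rewrite /A A_poly_linearized // horner_linearizedB.
have LB x y : L.[x - y] = L.[x] - L.[y] by rewrite horner_linearizedB.
have fE x : (A ^+ m + L).[x] = A.[x] ^+ m + L.[x] by rewrite hornerD horner_exp.
have alphaL x : alphaP.[L.[x]] = 0 by apply: horner_Dickson_ker.
have Am_frob x : (A.[x] ^+ m) ^+ q = (b ^+ m) ^+ q * A.[x] ^+ m.
  by rewrite -exprM mulnC exprM A_poly_frobenius // exprMn -!exprM mulnC.
set S := \sum_(i < _) _.
(* This identity isolates the nonlinear part of the polynomial. *)
have alphaf y : alphaP.[(A ^+ m + L).[y]] = A.[y] ^+ m * S.
  transitivity alphaP.[A.[y] ^+ m].
    rewrite fE -[in RHS](addrK L.[y] (_ ^+ m)) horner_linearizedB //.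
    by rewrite alphaL subr0.
  rewrite (horner_linearized_eigen _ (Am_frob y)); congr (_ * _).
  by apply: eq_bigr => i _; rewrite exprM.
have [x0 /andP[x0_neq0 /eqP Lx0]] : exists x, (x != 0) && (L.[x] == 0).
  apply/existsP; apply: contraT => /existsPn kerL; case: L_not_perm.
  apply: injF_bij => x y Lxy; apply/eqP; rewrite -subr_eq0.
  by have := kerL (x - y); rewrite LB Lxy subrr eqxx andbT negbK.
rewrite (subn1 n.+2); split=> [/bij_inj f_inj | [g1 _ S_neq0 detB]].
  have kerAL x : A.[x] = 0 -> L.[x] = 0 -> x = 0.
    move=> Ax Lx; apply: f_inj; rewrite !fE Ax Lx.
    by have := AB 0 0; have := LB 0 0; rewrite !subrr => -> ->.
  have detB : \det (B_mx q b a) != 0 by apply: ker_det_B Lx0 kerAL.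
  split=> //; last 1 first.
  (* If S = 0, the image of the permutation lies in the kernel of alphaP. *)
  - apply/eqP => S0; case/eqP: alpha_neq0; apply/colP => i; rewrite mxE.
    move: i; apply: (linearized_roots_eq0 q_gt1 (R := [set: F])) => // [y _|].
      have [g _ gK] := injF_bij f_inj.
      by rewrite -(gK y) -/alphaP alphaf S0 mulr0.
    by rewrite cardsT cardF ltn_exp2l.
  (* Scaling by an m-th root of unity u with u^q = u fixes the value at x0. *)
  - apply/eqP; apply: contraT.
    move=> /(exists_nontrivial_root cardF q_gt1)[u [u_neq1 um uq]].
    case/eqP: u_neq1; apply: (mulIf x0_neq0); rewrite mul1r; apply: f_inj.
    rewrite !fE /A A_poly_linearized // !horner_linearizedM // Lx0 mulr0.
    by rewrite exprMn um mul1r.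
  exact: rank_Dickson alpha_sol detB.
apply: injF_bij => x y fxy.
have Am : A.[x] ^+ m = A.[y] ^+ m.
  by apply: (mulIf S_neq0); rewrite -!alphaf fxy.
have Lxy : L.[x - y] = 0.
  by apply/eqP; rewrite LB subr_eq0; move: fxy; rewrite !fE Am => /addrI->.
apply/eqP; rewrite -subr_eq0; apply/eqP.
apply: (det_B_ker q_pchar q_gt1 cardF detB) => //.
apply/eqP; rewrite AB subr_eq0.
have [Ay|Ay] := eqVneq A.[y] 0.
  by move/eqP: Am; rewrite Ay expr0n eqn0Ngt m_gt0 expf_eq0 m_gt0.
(* A(x) and A(y) lie on the same line, so their ratio is fixed by Frobenius. *)
rewrite -(divfK Ay A.[x]) (@coprime_expr_eq1 _ q m (A.[x] / A.[y])) ?mul1r //.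
  by rewrite expr_div_n Am divff // expf_neq0.
apply: (mulIf (expf_neq0 q Ay)).
by rewrite -exprMn divfK // !A_poly_frobenius // mulrCA divfK.
Qed.
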